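(* Let $p$ be an odd prime and $G=D_{4p}$. (1) The odd values of the group determinant $\mathscr{D}_G$ at integer arguments are exactly the integers $m\equiv 1 \pmod 4$ with $p\nmid m$ or $p^3\mid m$. (2) The nonzero even values of $\mathscr{D}_G$ at integer arguments are exactly the integers of the form $2^a p^b m$, where $m$ is any integer with $\gcd(m,2p)=1$, $a,b$ are nonnegative integers, $a=4$ or $a\ge 6$, and $b=0$ or $b\ge 3$.
   Context: For a finite group $G=\{g_1,\ldots,g_N\}$ and variables $x_g$ ($g\in G$), the group determinant is the $N\times N$ determinant $\mathscr{D}_G(x_{g_1},\ldots,x_{g_N})=\det\left(x_{g_ig_j^{-1}}\right)_{1\le i,j\le N}$; integer arguments means $(x_{g_1},\ldots,x_{g_N})\in\mathbb{Z}^N$. $D_{2n}=\langle R,F \mid R^n=1,\ F^2=1,\ RF=FR^{n-1}\rangle$ denotes the dihedral group of order $2n$ (so $D_{4p}$ is the dihedral group of order $4p$, i.e. $n=2p$). *)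

(* Defs.v *)
From mathcomp Require Import all_boot all_order all_algebra all_fingroup.
From mathcomp Require Import all_solvable.

Set Implicit Arguments.
Unset Strict Implicit.
Unset Printing Implicit Defensive.

Import GRing.Theory.
Local Open Scope ring_scope.

(* Rows and columns are indexed by the same enumeration of the group, so the  *)
(* value does not depend on the choice of enumeration.                        *)
Definition group_det (R : comPzRingType) (gT : finGroupType)
    (x : {ffun gT -> R}) : R :=
  \det (\matrix_(i < #|gT|, j < #|gT|) x (enum_val i * (enum_val j)^-1)%g).

(* Main.v *)
Require Import Defs.
From mathcomp Require Import all_boot all_order all_algebra all_fingroup.
From mathcomp Require Import all_solvable all_field.
From mathcomp Require Import ring zify.

Set Implicit Arguments.
Unset Strict Implicit.
Unset Printing Implicit Defensive.

Import GRing.Theory Num.Theory.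
Local Open Scope ring_scope.

(** Write an element of [Z[D_{4p}]] as [f + g s], with [f] and [g] polynomials
in the rotation [r].  A discrete Fourier transform over the [2p]-th roots of
unity splits the group matrix into 2 x 2 blocks, so the determinant is the
product, over these roots [w], of
  [h(w) = f(w) f(1/w) - g(w) g(1/w)]  ([group_det_dihedral]).
The roots are [1], [-1] and [w^j], [-w^j] for [w] primitive of order [p] and
[0 < j < p].  Since [h(w) = h(1/w)], this reads
  [v = h(1) h(-1) A^2 B^2],
where [A] and [B] are the products of [h] over one half of the roots of order
[p] and of order [2p] respectively ([dnorm_prod_factor]).

Necessity.  [h] is an integral polynomial [H] in [w + 1/w], so [A] and [B] are
norms from the real subfield of the [p]-th cyclotomic field: they are integers,
being determinants of [H] and of [H(-X)] at the companion matrix of the minimal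
polynomial of [w + 1/w].  Modulo 2 the two agree.  Modulo the prime [1 - w]
above [p] every [w^j] becomes [1], so [p] divides [A] iff it divides [h(1)], and
[B] iff [h(-1)]; hence [p | v] forces [p^3 | v].  The 2-adic conditions
follow from [A = B], [f(1) = f(-1)] and [g(1) = g(-1)] modulo 2, as
[h(1) = f(1)^2 - g(1)^2] and [h(-1) = f(-1)^2 - g(-1)^2].

Sufficiency.  The four linear characters of the group take on [f + g s] the
values [f(1) + g(1)], [f(1) - g(1)], [f(-1) + g(-1)], [f(-1) - g(-1)].  Adding
to [f] and [g] multiples of [1 + X^2 + ... + X^(2p-2)] leaves [h] alone outside
[1] and [-1] and moves these values by arbitrary multiples of [p] of compatible
parity ([interpolate_pm1]).  So only the values modulo [p] matter, and those are
multiplicative.  Elements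
  [(1 + r + ... + r^(2l)) + (1 + ... + r^(2l-1)) s],
for which [h] is a cyclotomic unit outside [1] and [-1], and their twists by
linear characters, give all quadruples of nonzero residues with
[A^2 B^2 = 1]; multiplying by [1 + (-1 + r - r^2) s] makes the first residue
vanish at the cost of [A^2 B^2 = p^2].  Three choices of the four integers then
reach every value allowed by the necessary conditions. *)

(** * The group matrix of a dihedral group *)

(** Diagonal blocks commute, so the determinant is computed as for a 2 x 2
matrix.  Clearing the lower left block requires [d] to have nonzero entries,
whence the detour through [d + 'X] over the polynomial ring. *)
Lemma det_block_diag (R : idomainType) n (a b c d : 'rV[R]_n) :
  \det (block_mx (diag_mx a) (diag_mx b) (diag_mx c) (diag_mx d)) =
  \prod_i (a 0 i * d 0 i - b 0 i * c 0 i).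
Proof.
pose up (v : 'rV[R]_n) := map_mx polyC v.
pose e := \row_i (('X + (d 0 i)%:P) : {poly R}).
have detX : \det (block_mx (diag_mx (up a)) (diag_mx (up b))
                           (diag_mx (up c)) (diag_mx e)) =
            \prod_i ((a 0 i)%:P * e 0 i - (b 0 i * c 0 i)%:P).
  have nz_e : \prod_i e 0 i != 0.
    by apply/prodf_neq0 => i _; rewrite mxE -size_poly_eq0 size_XaddC.
  have detK :
      \det (block_mx (diag_mx e) 0 (- diag_mx (up c)) 1%:M) = \prod_i e 0 i.
    by rewrite det_lblock det1 mulr1 det_diag.
  apply: (mulIf nz_e); rewrite -{1}detK -det_mulmx.
  rewrite mulmx_block !mulmx1 !mulmxN !mulmx0 !add0r.
  rewrite [diag_mx (up c) *m _]diag_mxC subrr det_ublock det_diag !mulmx_diag.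
  rewrite -linearB /= det_diag; congr (_ * _).
  by apply: eq_bigr => i _; rewrite !mxE rmorphM.
have /(congr1 (horner_eval 0)) := detX.
rewrite -det_map_mx rmorph_prod /= map_block_mx !map_diag_mx => det0.
transitivity (\det (block_mx (diag_mx (map_mx (horner_eval 0) (up a)))
    (diag_mx (map_mx (horner_eval 0) (up b)))
    (diag_mx (map_mx (horner_eval 0) (up c)))
    (diag_mx (map_mx (horner_eval 0) e)))).
  congr (\det (block_mx (diag_mx _) (diag_mx _) (diag_mx _) (diag_mx _)));
  by apply/rowP => i; rewrite !mxE /= /horner_eval !hornerE.
by rewrite det0; apply: eq_bigr => i _; rewrite !mxE /horner_eval !hornerE.
Qed.

Lemma group_det_reindex (R : comPzRingType) (gT : finGroupType) (N : nat)
    (e : 'I_N -> gT) (x : {ffun gT -> R}) :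
  bijective e -> \det (\matrix_(i, j) x (e i * (e j)^-1)%g) = group_det x.
Proof.
move=> bij_e; have defN : N = #|gT| by rewrite -(bij_eq_card bij_e) card_ord.
subst N; have inj_s : injective (enum_rank \o e).
  by apply: inj_comp; [apply: enum_rank_inj | apply: bij_inj].
pose M := \matrix_(i < #|gT|, j < #|gT|) x (enum_val i * (enum_val j)^-1)%g.
have -> : \matrix_(i, j) x (e i * (e j)^-1)%g =
          row_perm (perm inj_s) (col_perm (perm inj_s) M).
  by apply/matrixP => i j; rewrite !mxE !permE /= !enum_rankK.
rewrite -[group_det x]/(\det M) row_permE col_permE !det_mulmx !det_perm.
by rewrite odd_permV mulrCA -signr_addb addbb mulr1.
Qed.

Lemma sum_periodic (V : nmodType) n (u : nat -> V) j :
  (forall i, u (i + n)%N = u i) -> \sum_(i < n) u (i + j)%N = \sum_(i < n) u i.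
Proof.
move=> u_per; elim: j => [|j IHj].
  by apply: eq_bigr => i _; rewrite addn0.
rewrite -[RHS]IHj; case: n u_per {IHj} => [|n] u_per.
  by rewrite !big_ord0.
rewrite big_ord_recr big_ord_recl /= addrC -addSnnS addnC u_per add0n.
by congr (_ + _); apply: eq_bigr => i _; rewrite /bump /= add1n addSnnS.
Qed.

Lemma unitmx_powers (F : fieldType) n (z : 'I_n -> F) :
  injective z -> \matrix_(k < n, i < n) z k ^+ i \in unitmx.
Proof.
move=> inj_z; rewrite -unitmx_tr unitmxE unitfE.
have -> : (\matrix_(k < n, i < n) z k ^+ i)^T = Vandermonde n (\row_k z k).
  by apply/matrixP => i k; rewrite !mxE.
rewrite det_Vandermonde; apply/prodf_neq0 => i _; apply/prodf_neq0 => j ltij.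
by rewrite !mxE subr_eq0 (inj_eq inj_z) -val_eqE neq_ltn ltij orbT.
Qed.

Definition dihedral_elt (gT : finGroupType) (r s : gT) n
    (k : 'I_(n + n)) : gT :=
  match split k with inl i => r ^+ i | inr i => r ^+ i * s end%g.

Lemma dihedral_eltl (gT : finGroupType) (r s : gT) n (i : 'I_n) :
  dihedral_elt r s (lshift n i) = (r ^+ i)%g.
Proof. by rewrite /dihedral_elt (unsplitK (inl i)). Qed.

Lemma dihedral_eltr (gT : finGroupType) (r s : gT) n (i : 'I_n) :
  dihedral_elt r s (rshift n i) = (r ^+ i * s)%g.
Proof. by rewrite /dihedral_elt (unsplitK (inr i)). Qed.

Lemma dihedral_elt_bij (gT : finGroupType) (r s : gT) n :
    (r ^+ n = 1)%g -> (s ^+ 2 = 1)%g -> (r ^ s = r^-1)%g ->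
    (<[r]> <*> <[s]> = [set: gT])%g -> #|gT| = (n + n)%N ->
  bijective (@dihedral_elt _ r s n).
Proof.
move=> rn s2 rs genG cardG; set e := @dihedral_elt _ r s n.
have n_gt0 : (0 < n)%N.
  by have := cardG_gt0 [set: gT]; rewrite cardsT cardG; case: (n).
have surj_e y : exists k, e k = y.
  have: y \in (<[r]> <*> <[s]>)%g by rewrite genG inE.
  rewrite norm_joinEr; last first.
    by rewrite cycle_subG; apply/normP; rewrite -cycleJ rs cycleV.
  have rX i : exists j : 'I_n, (r ^+ i = r ^+ j)%g.
    by exists (Ordinal (ltn_pmod i n_gt0)); rewrite /= expg_mod.
  case/mulsgP => _ _ /cycleP[i ->] /cycleP[j ->] ->; have [k ->] := rX i.
  rewrite -(expg_mod j s2) modn2; case: (odd j); last first.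
    by exists (lshift n k); rewrite /e dihedral_eltl mulg1.
  by exists (rshift n k); rewrite /e dihedral_eltr.
apply: inj_card_bij; last by rewrite cardG card_ord.
have: codom e =i gT by move=> y; have [k <-] := surj_e y; rewrite codom_f.
move=> /eq_card; rewrite cardG -{2}(card_ord (n + n)) => /eqP/image_injP inj_e.
by move=> k l; apply: inj_e.
Qed.

(** In the enumeration [r^i], [r^i s] the group matrix has the circulant block
[f_(i-j)] twice on the diagonal and the block [g_(i+j)] twice off it.  Let [W]
be the Fourier matrix of [z] and [W'] that of [1/z].  Multiplying [W] by the
first block only scales its rows, by the values of [f]; multiplying it by the
second one turns it into [W'] with rows scaled by the values of [g]. *)
Lemma group_det_dihedral (F : fieldType) (gT : finGroupType) (r s : gT) n
    (z : 'I_n -> F) (x : {ffun gT -> F}) :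
    (r ^+ n = 1)%g -> (s ^+ 2 = 1)%g -> (r ^ s = r^-1)%g ->
    (<[r]> <*> <[s]> = [set: gT])%g -> #|gT| = (n + n)%N ->
    injective z -> (forall k, z k ^+ n = 1) ->
  let f w := \sum_(i < n) x (r ^+ i)%g * w ^+ i in
  let g w := \sum_(i < n) x (r ^+ i * s)%g * w ^+ i in
  group_det x = \prod_k (f (z k) * f (z k)^-1 - g (z k) * g (z k)^-1).
Proof.
move=> rn s2 rs genG cardG inj_z z_n f g.
have sV : (s^-1 = s)%g by apply/eqP; rewrite eq_invg_mul -expg2 s2.
have srX i : (s * r ^- i = r ^+ i * s)%g.
  have rXs : (r ^+ i = (s * r ^- i) * s)%g.
    have -> : (s * r ^- i * s = (r ^- i) ^ s)%g by rewrite conjgE sV mulgA.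
    by rewrite conjVg conjXg rs expgVn invgK.
  by rewrite [in RHS]rXs -[RHS]mulgA -expg2 s2 mulg1.
have n_gt0 : (0 < n)%N.
  by have := cardG_gt0 [set: gT]; rewrite cardsT cardG; case: (n).
have bij_e := dihedral_elt_bij rn s2 rs genG cardG.
rewrite -(group_det_reindex x bij_e); set X := \matrix_(i, j) _.
pose W := \matrix_(k < n, i < n) z k ^+ i.
pose W' := \matrix_(k < n, i < n) (z k)^-1 ^+ i.
have z_neq0 k : z k != 0.
  apply: contra_eq_neq (z_n k) => ->.
  by rewrite expr0n -[n]prednK // eq_sym oner_eq0.
have W_unit : \det (block_mx W 0 0 W') != 0.
  rewrite det_lblock mulf_neq0 //.
    by rewrite -unitfE -unitmxE unitmx_powers.
  rewrite -unitfE -unitmxE; apply: (@unitmx_powers _ _ (fun k => (z k)^-1)).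
  by move=> k l /invr_inj/inj_z.
have fourier w (h : gT) j : w ^+ n = 1 -> w != 0 ->
    \sum_(i < n) w ^+ i * x (r ^+ i * (r ^- j * h))%g =
    w ^+ j * \sum_(i < n) x (r ^+ i * h)%g * w ^+ i.
  move=> wn1 w_neq0; pose u i := w ^+ i * x (r ^+ i * (r ^- j * h))%g.
  rewrite -(@sum_periodic _ n u j) => [|i]; last first.
    by rewrite /u !(exprD, expgD) wn1 rn mulr1 mulg1.
  rewrite mulr_sumr; apply: eq_bigr => i _; rewrite /u expgD mulgA mulgK.
  by rewrite exprD; ring.
have fourierN w (h : gT) j : w ^+ n = 1 -> w != 0 ->
    \sum_(i < n) w ^+ i * x (r ^+ i * (r ^+ j * h))%g =
    w^-1 ^+ j * \sum_(i < n) x (r ^+ i * h)%g * w ^+ i.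
  move=> wn1 w_neq0; apply: (mulfI (expf_neq0 j w_neq0)).
  rewrite mulrA -exprMn mulfV // expr1n mul1r.
  pose u i := x (r ^+ i * h)%g * w ^+ i.
  rewrite -(@sum_periodic _ n u j) => [|i]; last first.
    by rewrite /u !(exprD, expgD) wn1 rn mulr1 mulg1.
  rewrite mulr_sumr; apply: eq_bigr => i _.
  by rewrite /u expgD exprD !mulgA; ring.
have zV_n k : (z k)^-1 ^+ n = 1 by rewrite exprVn z_n invr1.
have zV_neq0 k : (z k)^-1 != 0 by rewrite invr_eq0.
apply: (mulfI W_unit); rewrite -det_mulmx.
(* the factor [1] gives the diagonal blocks the shape that [fourier] expects *)
have -> : X = block_mx (\matrix_(i, j) x (r ^+ i * (r ^- j * 1))%g)
                       (\matrix_(i, j) x (r ^+ i * (r ^+ j * s))%g)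
                       (\matrix_(i, j) x (r ^+ i * (r ^+ j * s))%g)
                       (\matrix_(i, j) x (r ^+ i * (r ^- j * 1))%g).
  apply/matrixP => i j; rewrite -[i]splitK -[j]splitK.
  case: (split i) => {}i; case: (split j) => {}j;
    rewrite ?(block_mxEul, block_mxEur, block_mxEdl, block_mxEdr) !mxE;
    rewrite ?(dihedral_eltl, dihedral_eltr) ?mulg1 //.
  - by rewrite invMg sV srX.
  - by rewrite -mulgA srX.
  - by rewrite invMg sV mulgA -[(_ * s * s)%g]mulgA -expg2 s2 mulg1.
transitivity (\det (block_mx
    (diag_mx (\row_k f (z k))) (diag_mx (\row_k g (z k)))
    (diag_mx (\row_k g (z k)^-1)) (diag_mx (\row_k f (z k)^-1))
  *m block_mx W 0 0 W')); last first.
  rewrite det_mulmx det_block_diag mulrC; congr (_ * _).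
  by apply: eq_bigr => k _; rewrite !mxE.
congr (\det _); rewrite !mulmx_block !mulmx0 !mul0mx !addr0 !add0r.
have f1 w : f w = \sum_(i < n) x (r ^+ i * 1)%g * w ^+ i.
  by apply: eq_bigr => i _; rewrite mulg1.
congr block_mx; rewrite mul_diag_mx; apply/matrixP => k j; rewrite !mxE.
- by rewrite f1 mulrC -fourier //; apply: eq_bigr => i _; rewrite !mxE.
- by rewrite /g mulrC -fourierN //; apply: eq_bigr => i _; rewrite !mxE.
- have := fourierN (z k)^-1 s j (zV_n k) (zV_neq0 k).
  rewrite invrK /g mulrC => <-.
  by apply: eq_bigr => i _; rewrite !mxE.
- by rewrite f1 mulrC -fourier //; apply: eq_bigr => i _; rewrite !mxE.
Qed.

Lemma dihedral_generators q : (1 < q)%N -> exists r s : 'D_(q.*2),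
  [/\ r ^+ q = 1, s ^+ 2 = 1, r ^ s = r^-1 &
      <[r]> <*> <[s]> = [set: 'D_(q.*2)]]%g.
Proof.
move=> q_gt1; have := Grp_dihedral q_gt1 [set: 'D_(q.*2)]%G; rewrite homg_refl.
move=> /esym/existsP[[r s]] /=; rewrite !xpair_eqE.
by case/and4P=> /eqP genG /eqP rq /eqP s2 /eqP rs; exists r, s.
Qed.

(** * Evaluating integral polynomials at roots of unity *)

Definition ev (f : {poly int}) (w : algC) : algC := (map_poly intr f).[w].

Lemma evD f g w : ev (f + g) w = ev f w + ev g w.
Proof. by rewrite /ev rmorphD hornerD. Qed.

Lemma evN f w : ev (- f) w = - ev f w.
Proof. by rewrite /ev rmorphN hornerN. Qed.

Lemma evM f g w : ev (f * g) w = ev f w * ev g w.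
Proof. by rewrite /ev rmorphM hornerM. Qed.

Lemma evC a w : ev a%:P w = a%:~R.
Proof. by rewrite /ev map_polyC hornerC. Qed.

Lemma ev1 w : ev 1 w = 1.
Proof. by rewrite /ev rmorph1 hornerC. Qed.

Lemma evX w : ev 'X w = w.
Proof. by rewrite /ev map_polyX hornerX. Qed.

Lemma evXn n w : ev 'X^n w = w ^+ n.
Proof. by rewrite /ev map_polyXn hornerXn. Qed.

Lemma ev_comp f g w : ev (f \Po g) w = ev f (ev g w).
Proof. by rewrite /ev map_comp_poly horner_comp. Qed.

Lemma ev_sum I (r : seq I) (P : pred I) (F : I -> {poly int}) w :
  ev (\sum_(i <- r | P i) F i) w = \sum_(i <- r | P i) ev (F i) w.
Proof. by rewrite /ev rmorph_sum horner_sum. Qed.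

Lemma ev_int f (a : int) : ev f a%:~R = f.[a]%:~R.
Proof. by rewrite /ev horner_map. Qed.

Definition evE := (evD, evN, evM, evC, ev1, evX, evXn, ev_comp).

Lemma ev_poly n (a : nat -> int) w :
  ev (\poly_(i < n) a i) w = \sum_(i < n) (a i)%:~R * w ^+ i.
Proof.
rewrite poly_def ev_sum; apply: eq_bigr => i _.
by rewrite -mul_polyC evM evC evXn.
Qed.

Lemma ev_geom k w : (w - 1) * ev (\sum_(i < k) 'X^i) w = w ^+ k - 1.
Proof.
rewrite subrX1 ev_sum; congr (_ * _).
by apply: eq_bigr => i _; rewrite evXn.
Qed.

Lemma ev_rmodp f n w : (0 < n)%N -> w ^+ n = 1 ->
  ev (Pdiv.CommonRing.rmodp f ('X^n - 1)) w = ev f w.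
Proof.
move=> n_gt0 wn; rewrite {2}(Pdiv.RingMonic.rdivp_eq (monicXnsubC 1 n_gt0) f).
by rewrite evD evM evD evN ev1 evXn wn subrr mulr0 add0r.
Qed.

Lemma prim_root_exp_neq0 n (om : algC) j : n.-primitive_root om -> om ^+ j != 0.
Proof.
move=> prim_om.
by rewrite expf_neq0 // (prim_root_eq0 prim_om) -lt0n (prim_order_gt0 prim_om).
Qed.

Lemma prim_root_exp_order n (om : algC) j :
  n.-primitive_root om -> (om ^+ j) ^+ n = 1.
Proof. by move=> prim_om; rewrite exprAC (prim_expr_order prim_om) expr1n. Qed.

Lemma prim_root_exp_neq1 n (om : algC) j :
  n.-primitive_root om -> (0 < j < n)%N -> om ^+ j != 1.
Proof.
move=> prim_om /andP[j_gt0 lt_j].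
rewrite -(expr0 om) (eq_prim_root_expr prim_om).
by rewrite !modn_small ?(leq_trans _ lt_j) // -lt0n.
Qed.

(** Raising to the odd power [n] gives [1] and [-1]. *)
Lemma odd_prim_root_opp n (om : algC) i j :
  n.-primitive_root om -> odd n -> om ^+ i != - om ^+ j.
Proof.
move=> prim_om odd_n; apply/eqP => /(congr1 (fun y => y ^+ n)).
rewrite exprNn !(prim_root_exp_order _ prim_om) -signr_odd odd_n mulr1 => /eqP.
by rewrite -addr_eq0 (_ : 1 + 1 = 2%:R :> algC) ?pnatr_eq0.
Qed.

Lemma prim_root_exp_inv n (om : algC) j :
  n.-primitive_root om -> (j <= n)%N -> om ^+ (n - j) = (om ^+ j)^-1.
Proof.
move=> prim_om le_j; apply: (mulfI (prim_root_exp_neq0 j prim_om)).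
rewrite mulfV ?(prim_root_exp_neq0 j prim_om) // -exprD subnKC //.
exact: prim_expr_order.
Qed.

Lemma prim_root_sqr n (om : algC) :
  n.-primitive_root om -> odd n -> n.-primitive_root (om ^+ 2).
Proof. by move=> p_om ?; rewrite (prim_root_exp_coprime _ p_om) coprime2n. Qed.

Lemma prod_prim_root_eval n (om y : algC) : n.-primitive_root om ->
  \prod_(1 <= j < n) (y - om ^+ j) = \sum_(i < n) y ^+ i.
Proof.
move=> prim_om; have n_gt0 := prim_order_gt0 prim_om.
have nzX1 : 'X - 1%:P != 0 :> {poly algC} by rewrite -size_poly_eq0 size_XsubC.
have cyc : \prod_(1 <= j < n) ('X - (om ^+ j)%:P) = \sum_(i < n) 'X^i.
  apply: (mulfI nzX1).
  have := factor_Xn_sub_1 prim_om; rewrite big_ltn // expr0 => ->.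
  by rewrite polyC1 subrX1.
have /(congr1 (horner_eval y)) := cyc.
rewrite /horner_eval horner_prod horner_sum.
under eq_bigr => j _ do rewrite hornerXsubC.
by move=> ->; apply: eq_bigr => i _; rewrite hornerXn.
Qed.

Lemma prod_1_sub_prim_root n (om : algC) : n.-primitive_root om ->
  \prod_(1 <= j < n) (1 - om ^+ j) = n%:R.
Proof.
move=> prim_om; rewrite prod_prim_root_eval //.
by under eq_bigr => i _ do rewrite expr1n; rewrite sumr_const card_ord.
Qed.

Lemma prod_prim_root_exp n (om : algC) : n.-primitive_root om -> odd n ->
  \prod_(1 <= j < n) om ^+ j = 1.
Proof.
move=> prim_om odd_n; have n_gt0 := prim_order_gt0 prim_om.
have sum0 : \sum_(i < n) 0 ^+ i = 1 :> algC.
  case: n n_gt0 {prim_om odd_n} => // n _.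
  by rewrite big_ord_recl big1 ?addr0 // => i _; rewrite expr0n.
rewrite -[RHS]sum0 -(prod_prim_root_eval 0 prim_om).
under [RHS]eq_bigr => j _ do rewrite sub0r -mulN1r.
have even_pred : odd n.-1 = false by apply: negbTE; rewrite -oddS prednK.
by rewrite big_split /= prodr_const_nat subn1 -signr_odd even_pred mul1r.
Qed.

(** Compare the products of [1 - w^j] for [w] and for [w^2], both equal to
[n]. *)
Lemma prod_1_add_prim_root n (om : algC) : n.-primitive_root om -> odd n ->
  \prod_(1 <= j < n) (1 + om ^+ j) = 1.
Proof.
move=> prim_om odd_n; have prim2 := prim_root_sqr prim_om odd_n.
have nzn : n%:R != 0 :> algC.
  by rewrite pnatr_eq0 -lt0n (prim_order_gt0 prim_om).
apply: (mulfI nzn); rewrite mulr1 -{1}(prod_1_sub_prim_root prim_om).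
rewrite -(prod_1_sub_prim_root prim2) -big_split.
by apply: eq_bigr => j _; rewrite /= -exprM mulnC exprM; ring.
Qed.

(** * The determinant as a product of norms *)

(** The determinant of the image of [f + g s] under the two-dimensional
representation that sends the rotation to [diag (w, 1/w)]. *)
Definition dnorm (f g : {poly int}) (w : algC) : algC :=
  ev f w * ev f w^-1 - ev g w * ev g w^-1.

Lemma dnorm_inv f g w : dnorm f g w^-1 = dnorm f g w.
Proof. by rewrite /dnorm invrK; congr (_ - _); rewrite mulrC. Qed.

Lemma dnorm1 f g : dnorm f g 1 = (f.[1] ^+ 2 - g.[1] ^+ 2)%:~R.
Proof. by rewrite /dnorm invr1 -[1]/(1%:~R) !ev_int -!rmorphM -rmorphB. Qed.

Lemma dnormN1 f g : dnorm f g (-1) = (f.[-1] ^+ 2 - g.[-1] ^+ 2)%:~R.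
Proof.
by rewrite /dnorm invrN invr1 -[-1]/((-1)%:~R) !ev_int -!rmorphM -rmorphB.
Qed.

(** Reduction modulo [X^(2p) - 1] turns polynomials of any size into the
coefficient functions of group ring elements without changing their values at
[2p]-th roots of unity, so arbitrary [f] and [g] may be used below. *)
Lemma group_det_values p (om : algC) (v : int) :
  prime p -> odd p -> p.-primitive_root om ->
  (exists x : {ffun 'D_(4 * p) -> int}, group_det x = v) <->
  (exists f g : {poly int},
     v%:~R = \prod_(j < p) (dnorm f g (om ^+ j) * dnorm f g (- om ^+ j))).
Proof.
move=> p_pr p_odd prim_om; have p_gt1 := prime_gt1 p_pr.
have -> : (4 * p = (p + p).*2)%N by lia.
have p2_gt1 : (1 < p + p)%N by lia.
have [r [s [rn s2 rs genG]]] := dihedral_generators p2_gt1.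
have cardG : #|'D_((p + p).*2)| = ((p + p) + (p + p))%N.
  by rewrite -cardsT card_dihedral // -addnn.
pose z (k : 'I_(p + p)) :=
  match split k with inl j => om ^+ j | inr j => - om ^+ j end.
have z_l j : z (lshift p j) = om ^+ j by rewrite /z (unsplitK (inl j)).
have z_r j : z (rshift p j) = - om ^+ j by rewrite /z (unsplitK (inr j)).
have z_n k : z k ^+ (p + p) = 1.
  rewrite -[k]splitK; case: (split k) => j /=;
    rewrite ?z_l ?z_r addnn -muln2 mulnC exprM ?sqrrN exprAC;
    by rewrite (prim_root_exp_order _ prim_om) expr1n.
have om_inj (i j : 'I_p) : om ^+ i = om ^+ j -> i = j.
  move/eqP; rewrite (eq_prim_root_expr prim_om) !modn_small //.
  by move/eqP/val_inj.
have om_neq i j : om ^+ i <> - om ^+ j.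
  by apply/eqP; apply: (odd_prim_root_opp i j prim_om).
have inj_z : injective z.
  move=> k l; rewrite -[k]splitK -[l]splitK.
  case: (split k) => i; case: (split l) => j /=; rewrite ?z_l ?z_r.
  - by move/om_inj->.
  - by move/om_neq.
  - by move/esym/om_neq.
  - by move/oppr_inj/om_inj->.
have det_val (x : {ffun 'D_((p + p).*2) -> int}) : (group_det x)%:~R =
    let f := \poly_(i < p + p) x (r ^+ i)%g in
    let g := \poly_(i < p + p) x (r ^+ i * s)%g in
    \prod_(j < p) (dnorm f g (om ^+ j) * dnorm f g (- om ^+ j)).
  have -> : (group_det x)%:~R = group_det [ffun y => (x y)%:~R : algC].
    rewrite /group_det -det_map_mx; congr (\det _).
    by apply/matrixP => i j; rewrite !mxE ffunE.
  rewrite (group_det_dihedral _ rn s2 rs genG cardG inj_z z_n) big_split_ord /=.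
  rewrite -big_split /=; apply: eq_bigr => j _ /=.
  rewrite z_l z_r /dnorm !ev_poly.
  by congr (_ * _); congr (_ * _ - _ * _); apply: eq_bigr => i _; rewrite ffunE.
split=> [[x <-]|[f [g vE]]]; first by do 2!eexists; apply: det_val.
pose red (q : {poly int}) := Pdiv.CommonRing.rmodp q ('X^(p + p) - 1).
have size_red q : (size (red q) <= p + p)%N.
  rewrite -ltnS -[X in (_ < X)%N](size_XnsubC (1 : int) (ltnW p2_gt1)).
  by rewrite Pdiv.CommonRing.ltn_rmodpN0 // -size_poly_eq0 size_XnsubC // ltnW.
have [e' eK _] := dihedral_elt_bij rn s2 rs genG cardG.
pose x := [ffun y =>
  match split (e' y) with inl i => (red f)`_i | inr i => (red g)`_i end].
have xr i : (i < p + p)%N -> x (r ^+ i)%g = (red f)`_i.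
  move=> lti; rewrite ffunE -(dihedral_eltl r s (Ordinal lti)) eK.
  by rewrite (unsplitK (inl (Ordinal lti))).
have xrs i : (i < p + p)%N -> x (r ^+ i * s)%g = (red g)`_i.
  move=> lti; rewrite ffunE -(dihedral_eltr r s (Ordinal lti)) eK.
  by rewrite (unsplitK (inr (Ordinal lti))).
have poly_red (a : nat -> int) q :
    (forall i, (i < p + p)%N -> a i = (red q)`_i) ->
    \poly_(i < p + p) a i = red q.
  move=> aE; apply/polyP => i; rewrite coef_poly; case: ltnP => [/aE //|le_i].
  by rewrite nth_default // (leq_trans (size_red q)).
exists x; apply: (@intr_inj algC); rewrite det_val vE /=.
rewrite (poly_red _ f) // (poly_red _ g) //.
have dnorm_red w : w ^+ (p + p) = 1 -> dnorm (red f) (red g) w = dnorm f g w.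
  by move=> wn; rewrite /dnorm !ev_rmodp ?exprVn ?wn ?invr1 // ltnW.
by apply: eq_bigr => j _; rewrite -(z_r j) -(z_l j) !dnorm_red.
Qed.

(** * Real cyclotomic norms *)

(** Both sides are multiplicative in [H], and for [H = 'X - c] the determinant
is a value of the characteristic polynomial; over an algebraically closed field
this suffices. *)
Lemma det_horner_mx n (M : 'M[algC]_n.+1) (rs : seq algC) (H : {poly algC}) :
  char_poly M = \prod_(r <- rs) ('X - r%:P) ->
  \det (horner_mx M H) = \prod_(r <- rs) H.[r].
Proof.
move=> charM; have size_rs : size rs = n.+1.
  by apply/succn_inj; rewrite -(size_char_poly M) charM size_prod_XsubC.
have prod_const (c : algC) : \prod_(r <- rs) c = c ^+ size rs.
  by rewrite big_const_seq count_predT iter_mulr mulr1.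
have det_sub c : \det (horner_mx M ('X - c%:P)) = \prod_(r <- rs) (r - c).
  have -> : \prod_(r <- rs) (r - c) = (-1) ^+ n.+1 * (char_poly M).[c].
    rewrite charM horner_prod -size_rs -prod_const -big_split.
    by apply: eq_bigr => r _; rewrite !hornerE /=; ring.
  rewrite rmorphB /= horner_mx_X horner_mx_C -[M - _]opprB -scaleN1r detZ.
  congr (_ * _).
  rewrite /char_poly -[RHS]/(horner_eval c _) -det_map_mx; congr (\det _).
  apply/matrixP => i j; rewrite !mxE /= /horner_eval !hornerE.
  by rewrite hornerMn hornerX.
have [ss ->] := closed_field_poly_normal H.
rewrite -mul_polyC rmorphM /= horner_mx_C rmorph_prod /=.
rewrite -[X in \det X]/(_ *m _) det_mulmx det_scalar.
rewrite (big_morph (@determinant _ n.+1) (@det_mulmx _ _) (det1 _ _)).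
under eq_bigr => c _ do rewrite det_sub.
rewrite exchange_big -size_rs -prod_const -big_split; apply: eq_bigr => r _.
rewrite hornerM hornerC horner_prod.
by congr (_ * _); apply: eq_bigr => c _; rewrite !hornerE.
Qed.

(** The norm of an integral polynomial in an algebraic integer is an integer,
because it is a determinant at the companion matrix. *)
Lemma int_norm (Psi H : {poly int}) (rs : seq algC) :
  Psi \is monic -> (1 < size Psi)%N ->
  map_poly intr Psi = \prod_(r <- rs) ('X - r%:P) ->
  exists A : int, A%:~R = \prod_(r <- rs) ev H r.
Proof.
move=> monPsi size_gt1 fact.
have [M charM] : exists M : 'M[int]_((size Psi).-2.+1), char_poly M = Psi.
  have -> : (size Psi).-2.+1 = (size Psi).-1 by lia.
  by exists (companionmx Psi); apply: companionmxK.
exists (\det (horner_mx M H)); rewrite -det_map_mx map_horner_mx.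
by rewrite (det_horner_mx (rs := rs)) // -map_char_poly charM.
Qed.

Lemma dickson_poly i : exists V : {poly int},
  forall z : algC, z != 0 -> ev V (z + z^-1) = z ^+ i + z^-1 ^+ i.
Proof.
suff [V [V' []]] : exists V V' : {poly int},
    (forall z : algC, z != 0 -> ev V (z + z^-1) = z ^+ i + z^-1 ^+ i) /\
    (forall z : algC, z != 0 -> ev V' (z + z^-1) = z ^+ i.+1 + z^-1 ^+ i.+1).
  by exists V.
elim: i => [|i [V [V' [IH IH']]]].
  by exists 2%:P, 'X; split=> z nz_z; rewrite !evE ?expr0 ?expr1.
exists V', ('X * V' - V); split=> // z nz_z.
by rewrite !evE IH // IH' // !exprS; field; rewrite nz_z ?oner_eq0.
Qed.

Lemma real_poly_trace (f : {poly int}) : exists K : {poly int},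
  forall z : algC, z != 0 -> ev K (z + z^-1) = ev f z + ev f z^-1.
Proof.
have [V VE] := fin_all_exists (fun i : 'I_(size f) => dickson_poly i).
exists (\sum_(i < size f) (f`_i)%:P * V i) => z nz_z.
have evf w : ev f w = \sum_(i < size f) (f`_i)%:~R * w ^+ i.
  by rewrite -{1}[f]coefK ev_poly.
rewrite ev_sum !evf -big_split; apply: eq_bigr => i _.
by rewrite evM evC VE //= mulrDr.
Qed.

Lemma real_poly_norm (f : {poly int}) : exists K : {poly int},
  forall z : algC, z != 0 -> ev K (z + z^-1) = ev f z * ev f z^-1.
Proof.
elim/poly_ind: f => [|f c [K KE]].
  by exists 0 => z _; rewrite /ev rmorph0 !horner0 mulr0.
have [L LE] := real_poly_trace ('X * f).
exists (K + c%:P * L + c%:P * c%:P) => z nz_z.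
by rewrite !evE KE // LE // !evE; field; rewrite nz_z ?oner_eq0.
Qed.

Lemma dnorm_real (f g : {poly int}) : exists H : {poly int},
  forall z : algC, z != 0 -> ev H (z + z^-1) = dnorm f g z.
Proof.
have [K KE] := real_poly_norm f; have [L LE] := real_poly_norm g.
by exists (K - L) => z nz_z; rewrite !evE KE ?LE.
Qed.

(** [Psi (z + 1/z)] is the sum of the [z^i] for [-k <= i <= k]; these
polynomials satisfy the recurrence of the Chebyshev family. *)
Lemma real_cyclotomic k : exists Psi : {poly int},
  [/\ Psi \is monic, size Psi = k.+1 & forall z : algC, z != 0 ->
      (z - 1) * z ^+ k * ev Psi (z + z^-1) = z ^+ k.*2.+1 - 1].
Proof.
pose P k (Psi : {poly int}) :=
  [/\ Psi \is monic, size Psi = k.+1 & forall z : algC, z != 0 ->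
      (z - 1) * z ^+ k * ev Psi (z + z^-1) = z ^+ k.*2.+1 - 1].
suff [A [B [PA PB]]] : exists A B, P k A /\ P k.+1 B by exists A.
elim: k => [|k [A [B [PA PB]]]].
  exists 1, ('X + 1%:P); split; split.
  - by rewrite monic1.
  - by rewrite size_poly1.
  - by move=> z _; rewrite ev1 expr0 expr1 !mulr1.
  - by rewrite monicXaddC.
  - by rewrite size_XaddC.
  - by move=> z nz_z; rewrite !evE /=; field; rewrite ?nz_z ?oner_eq0.
exists B, ('X * B - A); split=> //.
have [monA sA EA] := PA; have [monB sB EB] := PB.
have nzB : B != 0 by rewrite -size_poly_eq0 sB.
have ltAB : (size (- A)%R < size ('X * B)%R)%N.
  by rewrite size_polyN sA mulrC size_mulX // sB.
split.
- by rewrite monicE lead_coefDl // mulrC lead_coefMX -monicE.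
- by rewrite size_polyDl // mulrC size_mulX // sB.
move=> z nz_z; have /= a := EA z nz_z; have b := EB z nz_z; rewrite !evE.
transitivity ((z ^+ 2 + 1) * ((z - 1) * z ^+ k.+1 * ev B (z + z^-1)) -
              z ^+ 2 * ((z - 1) * z ^+ k * ev A (z + z^-1))).
  by rewrite !exprS; field; rewrite ?nz_z ?oner_eq0.
by rewrite a b !doubleS !exprS; ring.
Qed.

(** For [k = (p - 1) / 2] the roots of the polynomial [Psi] of
[real_cyclotomic] are the [w^j + w^-j], which are distinct for
[1 <= j <= k]. *)
Lemma half_real_factor p (om : algC) :
  prime p -> odd p -> p.-primitive_root om ->
  exists Psi : {poly int}, [/\ Psi \is monic, (1 < size Psi)%N &
    map_poly intr Psi =
    \prod_(1 <= j < p./2.+1) ('X - (om ^+ j + (om ^+ j)^-1)%:P)].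
Proof.
move=> p_pr odd_p prim_om; have p_gt1 := prime_gt1 p_pr.
have [Psi [mon_Psi size_Psi PsiE]] := real_cyclotomic p./2.
have pE := odd_double_half p; rewrite odd_p in pE.
have nz_om j : om ^+ j != 0 := prim_root_exp_neq0 j prim_om.
have neq1 j := prim_root_exp_neq1 (j := j) prim_om.
exists Psi; split=> //; first by rewrite size_Psi; lia.
pose c j := om ^+ j + (om ^+ j)^-1.
pose rs := [seq c j | j <- index_iota 1 p./2.+1].
have -> : \prod_(1 <= j < p./2.+1) ('X - (om ^+ j + (om ^+ j)^-1)%:P) =
          \prod_(r <- rs) ('X - r%:P) by rewrite big_map.
have size_PsiC : size (map_poly intr Psi : {poly algC}) = size Psi.
  by rewrite size_map_inj_poly //; apply: intr_inj.
have lead_map : lead_coef (map_poly intr Psi : {poly algC}) = 1.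
  by apply/eqP; rewrite -monicE monic_map.
have := @all_roots_prod_XsubC _ (map_poly intr Psi : {poly algC}) rs.
rewrite lead_map scale1r; apply.
- by rewrite size_PsiC size_Psi size_map size_iota; lia.
- apply/allP => _ /mapP[j + ->]; rewrite mem_index_iota => lt_j.
  have := PsiE _ (nz_om j).
  rewrite -add1n pE (prim_root_exp_order _ prim_om) subrr => /eqP.
  rewrite !mulf_eq0 subr_eq0 (negPf (neq1 j _)) /=; last by lia.
  by rewrite expf_eq0 (negPf (nz_om j)) andbF.
rewrite uniq_rootsE map_inj_in_uniq ?iota_uniq // => i j.
rewrite !mem_index_iota => lt_i lt_j /eqP; rewrite /c -subr_eq0.
have -> : om ^+ i + (om ^+ i)^-1 - (om ^+ j + (om ^+ j)^-1) =
   (om ^+ i - om ^+ j) * (om ^+ (i + j) - 1) / (om ^+ i * om ^+ j).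
  by rewrite exprD; field; rewrite !nz_om.
rewrite !mulf_eq0 invr_eq0 mulf_eq0 !(negPf (nz_om _)) !orbF !subr_eq0.
rewrite (negPf (neq1 (i + j)%N _)); last by lia.
rewrite orbF (eq_prim_root_expr prim_om) !modn_small; lia.
Qed.

Lemma Aint_ratio_int (d : nat) (a : int) : (0 < d)%N ->
  a%:~R / d%:R \in Aint -> (d %| a)%Z.
Proof.
move=> d_gt0 /Cint_rat_Aint.
rewrite rpred_div ?rpred_int ?rpred_nat // => /(_ isT)/intrP[m].
move/(canRL (divfK _)); rewrite pnatr_eq0 -lt0n => /(_ d_gt0).
by rewrite pmulrn -intrM => /intr_inj->; apply: dvdz_mull.
Qed.

(** The conjugates of [1 - w] are associate to it, and their product is [p]; so
if [1 - w] divides [a] then [p] divides [a^(p-1)]. *)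
Lemma prim_root_dvdA_int p (om : algC) (a : int) : prime p ->
  p.-primitive_root om -> (1 - om %| a%:~R)%A -> (p %| a)%Z.
Proof.
move=> p_pr prim_om dvd_a; have p_gt1 := prime_gt1 p_pr.
have neq1 j : (0 < j < p)%N -> 1 - om ^+ j != 0.
  by move=> jp; rewrite subr_eq0 eq_sym (prim_root_exp_neq1 prim_om).
have nz1 : 1 - om != 0 by rewrite -[om]expr1 neq1.
move: dvd_a; rewrite unfold_in (negPf nz1) => a_int.
have step j : (0 < j < p)%N -> a%:~R / (1 - om ^+ j) \in Aint.
  move=> jp; have /andP[j_gt0 ltjp] := jp.
  have cop : coprime j p by rewrite coprime_sym prime_coprime // gtnNdvd.
  have [k kE] : exists k, om = (om ^+ j) ^+ k.
    have prim_j : p.-primitive_root (om ^+ j).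
      by rewrite (prim_root_exp_coprime _ prim_om).
    have [k kE] := prim_rootP prim_j (prim_expr_order prim_om).
    by exists k.
  pose q := \sum_(i < k) 1 ^+ (k.-1 - i) * (om ^+ j) ^+ i.
  have -> : a%:~R / (1 - om ^+ j) = a%:~R / (1 - om) * q.
    have fac : 1 - om = (1 - om ^+ j) * q by rewrite -subrXX -kE expr1n.
    by apply: (mulfI nz1); rewrite {1}fac; field; rewrite nz1 neq1.
  rewrite rpredM // rpred_sum // => i _.
  by rewrite expr1n mul1r !rpredX // (Aint_prim_root prim_om).
have: \prod_(1 <= j < p) (a%:~R / (1 - om ^+ j)) \in Aint.
  by rewrite big_seq rpred_prod // => j; rewrite mem_index_iota; apply: step.
rewrite prodf_div prod_1_sub_prim_root // prodr_const_nat -rmorphXn /=.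
move/(Aint_ratio_int (prime_gt0 p_pr)); rewrite !dvdzE abszX Euclid_dvdX //.
by case/andP.
Qed.

Lemma ev_Aint f w : w \in Aint -> ev f w \in Aint.
Proof.
move=> Aw; apply: rpred_horner Aw; apply/polyOverP => i.
by rewrite coef_map Aint_int.
Qed.

Lemma ev_eqAmod f (e a b : algC) : a \in Aint -> b \in Aint ->
  (a == b %[mod e])%A -> (ev f a == ev f b %[mod e])%A.
Proof.
move=> Aa Ab eab; elim/poly_ind: f => [|f c IHf].
  by rewrite /ev rmorph0 !horner0.
rewrite !evE; apply: eqAmodD => //.
by apply: eqAmodM => //; apply: ev_Aint.
Qed.

Lemma prod_eqAmod (I : eqType) (r : seq I) (e : algC) (F G : I -> algC) :
  {in r, forall i, F i \in Aint} -> {in r, forall i, G i \in Aint} ->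
  {in r, forall i, F i == G i %[mod e]}%A ->
  (\prod_(i <- r) F i == \prod_(i <- r) G i %[mod e])%A.
Proof.
elim: r => [|i r IHr] AF AG FG; first by rewrite !big_nil.
have sub j : j \in r -> j \in i :: r by rewrite inE orbC => ->.
rewrite !big_cons; apply: eqAmodM; rewrite ?AF ?FG ?mem_head //.
  by rewrite big_seq rpred_prod // => j /sub/AG.
by apply: IHr => j /sub; [apply: AF | apply: AG | apply: FG].
Qed.

Lemma prim_root_inv_Aint n (om : algC) j :
  n.-primitive_root om -> (om ^+ j)^-1 \in Aint.
Proof.
move=> prim_om; rewrite -exprVn rpredX // (Aint_unity_root (n := n)) //.
  exact: prim_order_gt0 prim_om.
by apply/unity_rootP; rewrite exprVn (prim_expr_order prim_om) invr1.
Qed.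

Lemma prim_root_trace_Aint n (om : algC) j :
  n.-primitive_root om -> om ^+ j + (om ^+ j)^-1 \in Aint.
Proof.
move=> prim_om; rewrite rpredD ?(prim_root_inv_Aint _ prim_om) //.
by rewrite rpredX // (Aint_prim_root prim_om).
Qed.

(** Modulo the prime [1 - w] above [p], each [w^j + w^-j] becomes [2], so the
norm becomes a positive power of [H(2)]. *)
Lemma real_norm p (om : algC) (H : {poly int}) :
  prime p -> odd p -> p.-primitive_root om ->
  exists2 A : int,
    A%:~R = \prod_(1 <= j < p./2.+1) ev H (om ^+ j + (om ^+ j)^-1) &
    ((p%:Z %| A) = (p%:Z %| H.[2]))%Z.
Proof.
move=> p_pr odd_p prim_om.
have [Psi [mon_Psi size_Psi fact]] := half_real_factor p_pr odd_p prim_om.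
pose rs := [seq om ^+ j + (om ^+ j)^-1 | j <- index_iota 1 p./2.+1].
have [|A AE] := @int_norm Psi H rs mon_Psi size_Psi; first by rewrite big_map.
rewrite big_map in AE; exists A => //.
have Atr j := prim_root_trace_Aint j prim_om.
have cong : (A%:~R == (H.[2] ^+ p./2)%:~R %[mod 1 - om])%A.
  have -> : (H.[2] ^+ p./2)%:~R = \prod_(1 <= j < p./2.+1) ev H 2%:~R.
    by rewrite prodr_const_nat subn1 rmorphXn /= ev_int.
  rewrite AE; apply: prod_eqAmod => j _; rewrite ?ev_Aint ?Aint_int //.
  apply: ev_eqAmod; rewrite ?Aint_int //.
  have nz_om := prim_root_exp_neq0 j prim_om.
  pose q := - (\sum_(i < j) om ^+ i) * ((om ^+ j)^-1 * (om ^+ j - 1)).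
  have Aq : q \in Aint.
    have Aom : om \in Aint := Aint_prim_root prim_om.
    have AV := prim_root_inv_Aint j prim_om.
    rewrite rpredM ?rpredN ?rpred_sum ?rpredM ?rpredB ?rpredX // => i _.
    by rewrite rpredX.
  (* [z + 1/z - 2 = (z - 1)^2 / z] *)
  rewrite /eqAmod (_ : om ^+ j + (om ^+ j)^-1 - 2%:~R = (1 - om) * q).
    by rewrite -eqAmod0 eqAmodMr0.
  have -> : (1 - om) * q =
     ((om - 1) * \sum_(i < j) om ^+ i) * ((om ^+ j)^-1 * (om ^+ j - 1)).
    by rewrite /q; ring.
  by rewrite -subrX1; field.
have {}cong : (p%:Z %| A - H.[2] ^+ p./2)%Z.
  by apply: (prim_root_dvdA_int p_pr prim_om); rewrite rmorphB.
rewrite -(subrK (H.[2] ^+ p./2) A) rpredDl //.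
rewrite !dvdzE abszX Euclid_dvdX // (_ : (0 < p./2)%N) ?andbT //.
by have := odd_double_half p; have := prime_gt1 p_pr; rewrite odd_p; clear; lia.
Qed.

Lemma real_norm_opp_mod2 p (om : algC) (H : {poly int}) (A B : int) :
  p.-primitive_root om ->
  A%:~R = \prod_(1 <= j < p./2.+1) ev H (om ^+ j + (om ^+ j)^-1) ->
  B%:~R = \prod_(1 <= j < p./2.+1) ev H (- (om ^+ j + (om ^+ j)^-1)) ->
  (2 %| A - B)%Z.
Proof.
move=> prim_om AE BE; have Atr j := prim_root_trace_Aint j prim_om.
have: (A%:~R == B%:~R %[mod (2%:R : algC)])%A.
  rewrite AE BE; apply: prod_eqAmod => j _; rewrite ?ev_Aint ?rpredN //.
  apply: ev_eqAmod; rewrite ?rpredN // /eqAmod.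
  rewrite (_ : _ - _ = 2%:R * (om ^+ j + (om ^+ j)^-1)); last by ring.
  by rewrite -eqAmod0 eqAmodMr0.
rewrite /eqAmod unfold_in pnatr_eq0 /= -rmorphB /=.
exact: (@Aint_ratio_int 2).
Qed.

Lemma prod_reflect p (F : nat -> algC) : odd p ->
  (forall j, (0 < j < p)%N -> F (p - j)%N = F j) ->
  \prod_(1 <= j < p) F j = (\prod_(1 <= j < p./2.+1) F j) ^+ 2.
Proof.
move=> odd_p F_sym; have := odd_double_half p; rewrite odd_p.
move: (p./2) F_sym => m F_sym pE.
rewrite (@big_cat_nat _ _ _ m.+1) //=; [|by lia].
rewrite expr2; congr (_ * _); rewrite big_nat_rev /= -(add1n m) big_addn.
rewrite -pE (_ : (1 + m.*2 - m = 1 + m)%N); last by lia.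
apply: eq_big_nat => j /andP[j_gt0 lt_j]; rewrite -[RHS]F_sym; last by lia.
by congr F; lia.
Qed.

Lemma prod_dnorm_split p (om : algC) (f g : {poly int}) : (0 < p)%N ->
  \prod_(j < p) (dnorm f g (om ^+ j) * dnorm f g (- om ^+ j)) =
  (f.[1] ^+ 2 - g.[1] ^+ 2)%:~R * (f.[-1] ^+ 2 - g.[-1] ^+ 2)%:~R *
  \prod_(1 <= j < p) (dnorm f g (om ^+ j) * dnorm f g (- om ^+ j)).
Proof.
pose F j := dnorm f g (om ^+ j) * dnorm f g (- om ^+ j).
move=> p_gt0; rewrite -(big_mkord xpredT F) big_ltn //.
by rewrite /F expr0 dnorm1 dnormN1.
Qed.

(** [h] is invariant under inversion, so its product over the roots of order
[p], or over those of order [2p], is the square of a product over half of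
them. *)
Lemma dnorm_prod_factor p (om : algC) (f g : {poly int}) :
  prime p -> odd p -> p.-primitive_root om ->
  exists A B : int, [/\
     \prod_(j < p) (dnorm f g (om ^+ j) * dnorm f g (- om ^+ j)) =
        ((f.[1] ^+ 2 - g.[1] ^+ 2) * (f.[-1] ^+ 2 - g.[-1] ^+ 2) *
         A ^+ 2 * B ^+ 2)%:~R,
     (2 %| A - B)%Z,
     (p%:Z %| A)%Z = (p%:Z %| f.[1] ^+ 2 - g.[1] ^+ 2)%Z &
     (p%:Z %| B)%Z = (p%:Z %| f.[-1] ^+ 2 - g.[-1] ^+ 2)%Z].
Proof.
move=> p_pr odd_p prim_om; have [H HE] := dnorm_real f g.
have nz_om j : om ^+ j != 0 := prim_root_exp_neq0 j prim_om.
have [A AE A_p] := real_norm H p_pr odd_p prim_om.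
have [B BE B_p] := real_norm (H \Po (- 'X)) p_pr odd_p prim_om.
have {}BE : B%:~R =
    \prod_(1 <= j < p./2.+1) ev H (- (om ^+ j + (om ^+ j)^-1)).
  by rewrite BE; apply: eq_bigr => j _; rewrite !evE.
rewrite horner_comp !hornerE in B_p.
have dnorm_sym j : (0 < j < p)%N ->
    (dnorm f g (om ^+ (p - j)) = dnorm f g (om ^+ j)) *
    (dnorm f g (- om ^+ (p - j)) = dnorm f g (- om ^+ j)).
  case/andP=> _ /ltnW le_j.
  by rewrite (prim_root_exp_inv prim_om) // -invrN !dnorm_inv.
exists A, B; split.
- rewrite prod_dnorm_split ?prime_gt0 // big_split /=.
  rewrite !(prod_reflect odd_p); try by move=> j /dnorm_sym[].
  set a1 := (_ - _); set a2 := (_ - _).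
  have -> : (a1 * a2 * A ^+ 2 * B ^+ 2)%:~R =
      a1%:~R * a2%:~R * A%:~R ^+ 2 * B%:~R ^+ 2 :> algC.
    by rewrite -!rmorphXn -!rmorphM.
  rewrite AE BE mulrA; congr (_ * _ ^+ 2 * _ ^+ 2).
    by apply: eq_bigr => j _; rewrite HE.
  by apply: eq_bigr => j _; rewrite opprD -invrN HE ?oppr_eq0.
- exact: (real_norm_opp_mod2 prim_om AE BE).
- rewrite A_p; congr (_ %| _)%Z; apply: (@intr_inj algC).
  by rewrite -dnorm1 -HE ?oner_eq0 // invr1 -ev_int.
- rewrite B_p; congr (_ %| _)%Z; apply: (@intr_inj algC).
  rewrite -dnormN1 -HE ?oppr_eq0 ?oner_eq0 // invrN1 -ev_int.
  by rewrite rmorphN -opprD.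
Qed.

(** * Necessary conditions *)

Lemma horner_pm1_parity (f : {poly int}) : (2 %| f.[1] - f.[-1])%Z.
Proof.
elim/poly_ind: f => [|h c /dvdzP[k kE]]; first by rewrite !hornerE.
apply/dvdzP; exists (k + h.[-1]).
by rewrite !hornerE /= -[h.[1]](subrK h.[-1]) kE; ring.
Qed.

Lemma group_det_shape p (v : int) : prime p -> odd p ->
  (exists x : {ffun 'D_(4 * p) -> int}, group_det x = v) ->
  exists a b c d A B : int,
    [/\ (2 %| a - c)%Z, (2 %| b - d)%Z, (2 %| A - B)%Z,
        ((p%:Z %| A)%Z = (p%:Z %| a ^+ 2 - b ^+ 2)%Z) *
        ((p%:Z %| B)%Z = (p%:Z %| c ^+ 2 - d ^+ 2)%Z) &
        v = (a ^+ 2 - b ^+ 2) * (c ^+ 2 - d ^+ 2) * A ^+ 2 * B ^+ 2].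
Proof.
move=> p_pr odd_p; have [om prim_om] := C_prim_root_exists (prime_gt0 p_pr).
case/(group_det_values v p_pr odd_p prim_om) => f [g vE].
have [A [B [normE AB Ap Bp]]] := dnorm_prod_factor f g p_pr odd_p prim_om.
exists f.[1], g.[1], f.[-1], g.[-1], A, B.
rewrite !horner_pm1_parity; split=> //.
by apply: (@intr_inj algC); rewrite vE normE.
Qed.

Lemma Euclid_dvdzM p (x y : int) :
  prime p -> (p %| x * y)%Z = (p %| x)%Z || (p %| y)%Z.
Proof. by move=> p_pr; rewrite !dvdzE abszM Euclid_dvdM. Qed.

Lemma dvd2zM (x y : int) : (2 %| x * y)%Z = (2 %| x)%Z || (2 %| y)%Z.
Proof. exact: (@Euclid_dvdzM 2). Qed.

Lemma oddzP (x : int) : reflect (exists k, x = k * 2 + 1) (~~ (2 %| x)%Z).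
Proof.
apply: (iffP idP) => [x_odd|[k ->]]; last by lia.
by exists (x %/ 2)%Z; lia.
Qed.

Lemma dvd4_sqr (z : int) : (2 %| z)%Z -> (4 %| z ^+ 2)%Z.
Proof. by move=> z2; rewrite (dvdz_exp2r 2 z2). Qed.

(** The two differences of squares agree modulo 4, so [v] is a square modulo
4. *)
Lemma odd_value_mod4 (a b c d A B : int) :
  (2 %| a - c)%Z -> (2 %| b - d)%Z ->
  let v := (a ^+ 2 - b ^+ 2) * (c ^+ 2 - d ^+ 2) * A ^+ 2 * B ^+ 2 in
  ~~ (2 %| v)%Z -> (v = 1 %[mod 4])%Z.
Proof.
move=> /dvdzP[u uE] /dvdzP[w wE] v v_odd; apply/eqP; rewrite eqz_mod_dvd.
pose K := (c ^+ 2 - d ^+ 2) * A * B.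
have [k kE] : exists k, K = k * 2 + 1.
  apply/oddzP; apply: contra v_odd => /dvdzP[k kE]; apply/dvdzP.
  exists ((a ^+ 2 - b ^+ 2) * A * B * k); rewrite /v.
  transitivity ((a ^+ 2 - b ^+ 2) * A * B * K); first by rewrite /K; ring.
  by rewrite kE; ring.
pose q := (c * u + u ^+ 2 - d * w - w ^+ 2) * (A * B * K).
have vE : v = K ^+ 2 + 4 * q.
  by rewrite /v /q /K -[a](subrK c) -[b](subrK d) uE wE; ring.
by apply/dvdzP; exists (k ^+ 2 + k + q); rewrite vE {1}kE; ring.
Qed.

(** Squares of odd numbers agree modulo 8; for even numbers the quotient by 4 is
again a difference of squares, hence not 2 modulo 4. *)
Lemma diff_sqr_div4 (x y : int) : (2 %| x - y)%Z ->
  exists2 q, x ^+ 2 - y ^+ 2 = 4 * q &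
    if (2 %| x)%Z then (2 %| q)%Z -> (4 %| q)%Z else (2 %| q)%Z.
Proof.
have [/dvdzP[k ->]|/oddzP[k ->]] := boolP (2 %| x)%Z => /dvdzP[l lE].
  have -> : y = (k - l) * 2 by lia.
  exists (k ^+ 2 - (k - l) ^+ 2); first by ring.
  have -> : k ^+ 2 - (k - l) ^+ 2 = l * (2 * k - l) by ring.
  rewrite dvd2zM => /orP[] /dvdzP[m mE]; apply/dvdzP.
    by rewrite mE; exists (m * (k - m)); ring.
  have -> : l = 2 * (k - m) by lia.
  by exists ((k - m) * m); ring.
have -> : y = (k - l) * 2 + 1 by lia.
exists ((k ^+ 2 + k) - ((k - l) ^+ 2 + (k - l))); first by ring.
have even_pronic (z : int) : (2 %| z ^+ 2 + z)%Z.
  have [/dvdzP[m ->]|/oddzP[m ->]] := boolP (2 %| z)%Z; apply/dvdzP.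
    by exists (2 * m ^+ 2 + m); ring.
  by exists (2 * m ^+ 2 + 3 * m + 1); ring.
by rewrite rpredB.
Qed.

(** If the differences of squares are even, each is divisible by 4, with
quotients controlled by [diff_sqr_div4]; if they are odd, then [A] and [B] are
both even and the 2-adic valuation of [v] is that of a square. *)
Lemma even_value_dvd (a b c d A B : int) :
  (2 %| a - c)%Z -> (2 %| b - d)%Z -> (2 %| A - B)%Z ->
  let v := (a ^+ 2 - b ^+ 2) * (c ^+ 2 - d ^+ 2) * A ^+ 2 * B ^+ 2 in
  (2 %| v)%Z -> exists2 w, v = 16 * w & ((2 %| w)%Z -> (4 %| w)%Z).
Proof.
move=> ac bd AB v v_even.
have [X_even|X_odd] := boolP (2 %| a - b)%Z.
  have [x xE x2] := diff_sqr_div4 X_even.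
  have [|y yE y2] := @diff_sqr_div4 c d.
    by move: ac bd X_even; clear; lia.
  exists (x * y * A ^+ 2 * B ^+ 2); first by rewrite /v xE yE; ring.
  have par : (2 %| c)%Z = (2 %| a)%Z by move: ac; clear; lia.
  rewrite !expr2 !dvd2zM !orbb -!orbA.
  have [a_even|a_odd] := boolP (2 %| a)%Z;
    rewrite par ?a_even ?(negPf a_odd) in x2 y2.
    case/or4P=> [/x2|/y2|/dvd4_sqr|/dvd4_sqr] dvd4; rewrite -!expr2.
    - by rewrite !dvdz_mulr.
    - by rewrite -!mulrA dvdz_mull // dvdz_mulr.
    - by rewrite dvdz_mulr // dvdz_mull.
    - by rewrite dvdz_mull.
  move=> _; rewrite -!expr2 -mulrA dvdz_mulr //.
  case/dvdzP: x2 => k ->; case/dvdzP: y2 => l ->.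
  by apply/dvdzP; exists (k * l); ring.
have odd_sqr (x y : int) : ~~ (2 %| x - y)%Z -> ~~ (2 %| x ^+ 2 - y ^+ 2)%Z.
  by rewrite subr_sqr dvd2zM; lia.
have X2_odd := odd_sqr _ _ X_odd.
have Y2_odd : ~~ (2 %| c ^+ 2 - d ^+ 2)%Z.
  by apply: odd_sqr; move: X_odd ac bd; clear; lia.
have : (2 %| A)%Z && (2 %| B)%Z.
  move: v_even; rewrite /v !expr2 -!mulrA !dvd2zM -!expr2.
  by rewrite (negPf X2_odd) (negPf Y2_odd) /=; move: AB; clear; lia.
case/andP=> /dvdzP[A' AE] /dvdzP[B' BE].
exists ((a ^+ 2 - b ^+ 2) * (c ^+ 2 - d ^+ 2) * A' ^+ 2 * B' ^+ 2).
  by rewrite /v AE BE; ring.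
rewrite -2!mulrA !(dvd2zM (_ - _)) (negPf X2_odd) (negPf Y2_odd) /=.
rewrite expr2 expr2 !dvd2zM !orbb => /orP[]/dvd4_sqr dvd4; rewrite -!expr2.
  by apply: dvdz_mull; apply: dvdz_mull; apply: dvdz_mulr.
by do 3!apply: dvdz_mull.
Qed.

Lemma dvdz_value_cube p (X Y A B : int) : prime p ->
  (p%:Z %| A)%Z = (p%:Z %| X)%Z -> (p%:Z %| B)%Z = (p%:Z %| Y)%Z ->
  (p%:Z %| X * Y * A ^+ 2 * B ^+ 2)%Z ->
  (p%:Z ^+ 3 %| X * Y * A ^+ 2 * B ^+ 2)%Z.
Proof.
move=> p_pr AX BY p_dvd.
have {p_dvd} : (p%:Z %| X)%Z || (p%:Z %| Y)%Z.
  move: p_dvd; rewrite !expr2 !(@Euclid_dvdzM p) // AX BY.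
  by do 2!case: (_ %| _)%Z.
have cube (x y z : int) :
    (p%:Z %| x)%Z -> (p%:Z %| y)%Z -> (p%:Z ^+ 3 %| x * y ^+ 2 * z)%Z.
  move=> /dvdzP[k ->] /dvdzP[l ->]; apply/dvdzP.
  by exists (k * l ^+ 2 * z); ring.
case/orP=> [X_p|Y_p].
  have -> : X * Y * A ^+ 2 * B ^+ 2 = X * A ^+ 2 * (Y * B ^+ 2) by ring.
  by rewrite cube ?AX.
have -> : X * Y * A ^+ 2 * B ^+ 2 = Y * B ^+ 2 * (X * A ^+ 2) by ring.
by rewrite cube ?BY.
Qed.

Lemma int_2p_factor p (v : int) : prime p -> odd p -> v != 0 ->
  exists a b m, [/\ coprimez m (2 * p%:Z), v = 2 ^+ a * p%:Z ^+ b * m,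
    forall k, (2 ^+ k %| v)%Z = (k <= a)%N &
    forall k, (p%:Z ^+ k %| v)%Z = (k <= b)%N].
Proof.
move=> p_pr odd_p nz_v; have n_gt0 : (0 < `|v|)%N by rewrite absz_gt0.
have cop2p : coprime 2 p by rewrite coprime2n.
have [m1 cop2 n1] := pfactor_coprime (isT : prime 2) n_gt0.
have m1_gt0 : (0 < m1)%N by move: n_gt0; rewrite n1 muln_gt0 => /andP[].
have [m copp m1E] := pfactor_coprime p_pr m1_gt0.
set a := logn 2 `|v| in n1; set b := logn p m1 in m1E.
have logp : logn p `|v| = b.
  have logp2 : logn p 2 = 0%N by rewrite logn_coprime // coprime_sym.
  by rewrite n1 lognM ?expn_gt0 // lognX logp2 muln0 addn0.
exists a, b, ((-1) ^+ (v < 0)%R * m%:Z); split.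
- rewrite coprimezE abszMsign abszM !absz_nat coprimeMr.
  rewrite [coprime m 2]coprime_sym [coprime m p]coprime_sym copp andbT.
  by move: cop2; rewrite m1E coprimeMr => /andP[].
- by rewrite {1}[v]intEsign n1 m1E !PoszM -!rmorphXn /=; ring.
- by move=> k; rewrite dvdzE abszX pfactor_dvdn.
- by move=> k; rewrite dvdzE abszX absz_nat pfactor_dvdn // logp.
Qed.

(** * Elements with prescribed residues *)

(** Some [f + g s] takes at the four linear characters values congruent to
[c1], [c2], [c3], [c4] modulo [p], while the other factors of its determinant
multiply to [N]. *)
Definition local_values p (om : algC) (N : int) (c1 c2 c3 c4 : 'F_p) : Prop :=
  exists f g : {poly int},
    [/\ ((f.[1] + g.[1])%:~R = c1) * ((f.[1] - g.[1])%:~R = c2),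
        ((f.[-1] + g.[-1])%:~R = c3) * ((f.[-1] - g.[-1])%:~R = c4) &
        \prod_(1 <= j < p) (dnorm f g (om ^+ j) * dnorm f g (- om ^+ j)) =
        N%:~R].

Arguments local_values p om N c1 c2 c3 c4 : clear implicits.

(** This is multiplication in the group ring, where [s f(r) = f(1/r) s]; the
substitution of [X^(2p-1)] for [X] represents [f(1/r)]. *)
Lemma local_valuesM p (om : algC) (N N' : int)
    (c1 c2 c3 c4 d1 d2 d3 d4 : 'F_p) :
  p.-primitive_root om ->
  local_values p om N c1 c2 c3 c4 -> local_values p om N' d1 d2 d3 d4 ->
  local_values p om (N * N') (c1 * d1) (c2 * d2) (c3 * d3) (c4 * d4).
Proof.
move=> prim_om [f1 [g1 [[<- <-] [<- <-] NE]]] [f2 [g2 [[<- <-] [<- <-] NE']]].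
have n_gt0 : (0 < 2 * p)%N by rewrite muln_gt0 (prim_order_gt0 prim_om).
pose conj (f : {poly int}) := f \Po 'X^((2 * p).-1).
have conj1 f : (conj f).[1] = f.[1] by rewrite horner_comp hornerXn expr1n.
have conjN1 f : (conj f).[-1] = f.[-1].
  rewrite horner_comp hornerXn -signr_odd.
  by have -> : odd (2 * p).-1 by rewrite -[odd _]negbK -oddS prednK // oddM.
have conjE f w : w ^+ (2 * p) = 1 -> ev (conj f) w = ev f w^-1.
  move=> wn; rewrite /conj !evE; congr ev.
  have nz_w : w != 0.
    apply: contra_eq_neq wn => ->.
    by rewrite expr0n eqn0Ngt n_gt0 eq_sym oner_eq0.
  by apply: (mulfI nz_w); rewrite -exprS prednK // wn mulfV.
exists (f1 * f2 + g1 * conj g2), (f1 * g2 + g1 * conj f2); split.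
- by rewrite !(hornerD, hornerM) !conj1 -!rmorphM; split; congr _%:~R; ring.
- by rewrite !(hornerD, hornerM) !conjN1 -!rmorphM; split; congr _%:~R; ring.
rewrite rmorphM /= -NE -NE' -big_split; apply: eq_bigr => j _ /=.
have om_p : (om ^+ j) ^+ (2 * p) = 1.
  by rewrite mulnC exprM (prim_root_exp_order _ prim_om) expr1n.
have Nom_p : (- om ^+ j) ^+ (2 * p) = 1 by rewrite exprM sqrrN -exprM.
have dnormM w : w ^+ (2 * p) = 1 ->
    dnorm (f1 * f2 + g1 * conj g2) (f1 * g2 + g1 * conj f2) w =
    dnorm f1 g1 w * dnorm f2 g2 w.
  move=> wn; have wVn : w^-1 ^+ (2 * p) = 1 by rewrite exprVn wn invr1.
  by rewrite /dnorm !(evD, evM) !conjE // invrK; ring.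
by rewrite !dnormM //; ring.
Qed.

(** Twist by the linear character that sends [r] to [1] and [s] to [-1]. *)
Lemma local_values_twist_s p (om : algC) N (c1 c2 c3 c4 : 'F_p) :
  local_values p om N c1 c2 c3 c4 -> local_values p om N c2 c1 c4 c3.
Proof.
move=> [f [g [[<- <-] [<- <-] NE]]]; exists f, (- g).
rewrite !hornerN !opprK; split=> //.
by rewrite -NE; apply: eq_bigr => j _; rewrite /dnorm !evE !mulrNN.
Qed.

(** Twist by the linear character that sends [r] to [-1] and [s] to [1]. *)
Lemma local_values_twist_r p (om : algC) N (c1 c2 c3 c4 : 'F_p) :
  local_values p om N c1 c2 c3 c4 -> local_values p om N c3 c4 c1 c2.
Proof.
move=> [f [g [[<- <-] [<- <-] NE]]]; exists (f \Po - 'X), (g \Po - 'X).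
rewrite !horner_comp !hornerN !hornerX opprK; split=> //.
by rewrite -NE; apply: eq_bigr => j _; rewrite /dnorm !evE !invrN !opprK mulrC.
Qed.

Lemma geom_horner k (w : int) :
  (w - 1) * (\sum_(i < k) 'X^i : {poly int}).[w] = w ^+ k - 1.
Proof.
rewrite subrX1 horner_sum; congr (_ * _).
by apply: eq_bigr => i _; rewrite hornerXn.
Qed.

Lemma Fp_pow2_neq0 p k : prime p -> odd p -> (2 ^ k)%:R != 0 :> 'F_p.
Proof.
move=> p_pr odd_p; rewrite -(dvdn_pcharf (pchar_Fp p_pr)).
by rewrite -prime_coprime // coprimeXr // coprime_sym coprime2n.
Qed.

(** For [f = 1 + X + ... + X^(2l)] and [g = 1 + ... + X^(2l-1)] one finds
[h(w) = (1 - w^s) / ((1 - w) w^(2l))] with [s = 4l + 1], a cyclotomic unit when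
[p] does not divide [s].  Here [l] is chosen with [s = c] modulo [p]; an even
number of terms in [g] makes the values at [-1] equal to [1] and [0]. *)
Lemma local_values_unit1 p (om : algC) (c : 'F_p) :
  prime p -> odd p -> p.-primitive_root om ->
  c != 0 -> local_values p om 1 c 1 1 1.
Proof.
move=> p_pr odd_p prim_om nz_c.
have nz4 : 4%:R != 0 :> 'F_p := Fp_pow2_neq0 2 p_pr odd_p.
have [l lE] : exists l, l%:R = (c - 1) / 4%:R :> 'F_p.
  by exists (val ((c - 1) / 4%:R)); rewrite natr_Zp.
have l4 : (4 * l = l.*2 + l.*2)%N by clear; lia.
have [s sdef] : exists s, s = (4 * l).+1 by exists (4 * l).+1.
have sE : s%:R = c by rewrite sdef -addn1 natrD natrM lE mulrC divfK // subrK.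
have cop_s : coprime s p.
  by rewrite coprime_sym prime_coprime // (dvdn_pcharf (pchar_Fp p_pr)) sE.
pose f : {poly int} := \sum_(i < l.*2.+1) 'X^i.
pose g : {poly int} := \sum_(i < l.*2) 'X^i.
have geom1 k : (\sum_(i < k) 'X^i : {poly int}).[1] = k%:Z.
  rewrite horner_sum; under eq_bigr => i _ do rewrite hornerXn expr1n.
  by rewrite sumr_const card_ord pmulrn intz.
have fN1 : f.[-1] = 1.
  have := geom_horner l.*2.+1 (-1).
  rewrite -signr_odd /= odd_double /= expr1 -/f.
  by move: f.[-1] => u; clear; lia.
have gN1 : g.[-1] = 0.
  have := geom_horner l.*2 (-1).
  rewrite -signr_odd odd_double expr0 -/g.
  by move: g.[-1] => u; clear; lia.
exists f, g; rewrite !geom1 fN1 gN1 ?addr0 ?subr0; split=> //.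
- split; last by rewrite (_ : _ - _ = 1) //; clear; lia.
  by rewrite -sE sdef l4 -PoszD -[RHS]/(_%:R) -pmulrn addSn.
have nz_om j : om ^+ j != 0 := prim_root_exp_neq0 j prim_om.
have dnormE w : w != 0 -> w != 1 ->
    dnorm f g w = (1 - w ^+ s) / ((1 - w) * w ^+ l.*2).
  move=> nz_w w_neq1; have nz_w1 : w - 1 != 0 by rewrite subr_eq0.
  have nz_wV1 : w^-1 - 1 != 0 by rewrite subr_eq0 invr_eq1.
  have nz_1w : 1 - w != 0 by rewrite -opprB oppr_eq0.
  have evfE k u : u - 1 != 0 ->
      ev (\sum_(i < k) 'X^i) u = (u ^+ k - 1) / (u - 1).
    by move=> nz_u; rewrite -ev_geom mulrAC mulfV ?mul1r.
  rewrite sdef l4 /dnorm [ev f w]evfE // [ev g w]evfE // [ev f _]evfE //.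
  rewrite [ev g _]evfE // !exprVn !exprS exprD.
  have : w ^+ l.*2 != 0 by rewrite expf_neq0.
  move: (w ^+ l.*2) => t nz_t.
  by field; rewrite nz_w nz_1w nz_w1 nz_t.
have prim_s : p.-primitive_root (om ^+ s).
  by rewrite (prim_root_exp_coprime _ prim_om).
have neqN1 j : 1 != - om ^+ j.
  by rewrite -(expr0 om) (odd_prim_root_opp 0 j prim_om).
have -> : \prod_(1 <= j < p) (dnorm f g (om ^+ j) * dnorm f g (- om ^+ j)) =
  \prod_(1 <= j < p) (((1 - (om ^+ s) ^+ j) * (1 + (om ^+ s) ^+ j)) /
                      ((1 - om ^+ j) * (1 + om ^+ j) * (om ^+ j) ^+ (4 * l))).
  apply: eq_big_nat => j lt_j.
  have neq1 := prim_root_exp_neq1 prim_om lt_j.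
  rewrite !dnormE ?oppr_eq0 1?[- _ == _]eq_sym //.
  have nz1 : 1 - om ^+ j != 0 by rewrite subr_eq0 eq_sym.
  have nz2 : 1 + om ^+ j != 0 by rewrite -[om ^+ j]opprK subr_eq0.
  rewrite [om ^+ s ^+ j]exprAC [(- om ^+ j) ^+ s]exprNn.
  rewrite [(- om ^+ j) ^+ l.*2]exprNn -(signr_odd _ s) -(signr_odd _ l.*2).
  rewrite odd_double (_ : odd s); last by rewrite sdef /= oddM.
  have nzl : om ^+ j ^+ l.*2 != 0 by rewrite expf_neq0.
  by rewrite l4 exprD; field; rewrite nz1 nz2 nzl.
rewrite prodf_div !big_split /= !prod_1_sub_prim_root //.
rewrite !prod_1_add_prim_root // prodrXl prod_prim_root_exp //.
by rewrite expr1n !mulr1 mulfV // pnatr_eq0 -lt0n prime_gt0.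
Qed.

Lemma local_values_units p (om : algC) (c1 c2 c3 c4 : 'F_p) :
  prime p -> odd p -> p.-primitive_root om ->
  c1 != 0 -> c2 != 0 -> c3 != 0 -> c4 != 0 -> local_values p om 1 c1 c2 c3 c4.
Proof.
move=> p_pr odd_p prim_om nz1 nz2 nz3 nz4.
have unit1 (c : 'F_p) : c != 0 -> local_values p om 1 c 1 1 1.
  exact: local_values_unit1.
have lv2 := local_values_twist_s (unit1 _ nz2).
have lv3 := local_values_twist_r (unit1 _ nz3).
have lv4 := local_values_twist_r (local_values_twist_s (unit1 _ nz4)).
have lv12 := local_valuesM prim_om (unit1 _ nz1) lv2.
have := local_valuesM prim_om lv12 (local_valuesM prim_om lv3 lv4).
by rewrite !mulr1 !mul1r.
Qed.

(** For [f = 1] and [g = -1 + X - X^2], [h(w) = c (2 - c)] with [c = w + 1/w].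
Here [c] is a unit at [w^j] and [-w^j], and so is [2 - c = (1 - w)(1 - 1/w)]
at [-w^j], while its product over the [w^j] is [p^2]. *)
Lemma local_values_ramified1 p (om : algC) :
  prime p -> odd p -> p.-primitive_root om ->
  local_values p om (p%:Z ^+ 2) 0 2%:R (- 2%:R) 4%:R.
Proof.
move=> p_pr odd_p prim_om; exists 1, (- 1 + 'X - 'X^2); split.
- by rewrite !hornerE.
- by rewrite !hornerE.
have nz_om j : om ^+ j != 0 := prim_root_exp_neq0 j prim_om.
have prim2 := prim_root_sqr prim_om odd_p.
transitivity (\prod_(1 <= j < p)
  (((1 - om ^+ j) * (1 + om ^+ j) * (1 + om ^+ 2 ^+ j)) ^+ 2 / (om ^+ j) ^+ 4)).
  apply: eq_bigr => j _; rewrite /dnorm !evE exprAC.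
  by field; rewrite nz_om ?oner_eq0.
rewrite prodf_div !prodrXl !big_split /= prod_1_sub_prim_root //.
rewrite !prod_1_add_prim_root // prod_prim_root_exp // expr1n invr1 !mulr1.
by rewrite rmorphXn.
Qed.

Lemma local_values_ramified p (om : algC) (c2 c3 c4 : 'F_p) :
  prime p -> odd p -> p.-primitive_root om ->
  c2 != 0 -> c3 != 0 -> c4 != 0 -> local_values p om (p%:Z ^+ 2) 0 c2 c3 c4.
Proof.
move=> p_pr odd_p prim_om nz2 nz3 nz4.
have nzt : 2%:R != 0 :> 'F_p := Fp_pow2_neq0 1 p_pr odd_p.
have nzf : 4%:R != 0 :> 'F_p := Fp_pow2_neq0 2 p_pr odd_p.
have nzNt : - 2%:R != 0 :> 'F_p by rewrite oppr_eq0.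
have := local_valuesM prim_om (local_values_ramified1 p_pr odd_p prim_om)
  (local_values_units p_pr odd_p prim_om (oner_neq0 _)
     (mulf_neq0 nz2 (invr_neq0 nzt)) (mulf_neq0 nz3 (invr_neq0 nzNt))
     (mulf_neq0 nz4 (invr_neq0 nzf))).
by rewrite mulr1 mul0r !mulrA ![_ * _ / _]mulrAC !mulfV // !mul1r.
Qed.

(** * Attained values *)

(** [S = 1 + X^2 + ... + X^(2p-2)] is [p] at [1] and [-1] and vanishes at the
other [2p]-th roots of unity.  A factor [k + l X] of [S] takes at [1] and
[-1] arbitrary integers of the same parity. *)
Lemma interpolate_pm1 p (f : {poly int}) (a b : int) : odd p ->
  (p%:Z %| a - f.[1])%Z -> (p%:Z %| b - f.[-1])%Z -> (2 %| a - b)%Z ->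
  exists f' : {poly int}, [/\ f'.[1] = a, f'.[-1] = b &
    forall w, w ^+ 2 != 1 -> w ^+ (2 * p) = 1 -> ev f' w = ev f w].
Proof.
move=> odd_p /dvdzP[u uE] /dvdzP[w wE] /dvdzP[t tE].
have /dvdzP[q qE] := horner_pm1_parity f.
have [m mE] : exists m, p%:Z = m * 2 + 1.
  by exists p./2%:Z; have := odd_double_half p; rewrite odd_p; clear; lia.
have [r rE] : exists r, u - w = r * 2.
  exists (t - q - m * (u - w)); have := uE; have := wE; have := tE; have := qE.
  have: u * p%:Z - w * p%:Z = (u - w) + m * 2 * (u - w).
    by rewrite -mulrBl mE; ring.
  by clear; lia.
pose S : {poly int} := \sum_(i < p) 'X^(2 * i).
have S_pm (e : int) : e ^+ 2 = 1 -> S.[e] = p%:Z.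
  move=> e2; rewrite horner_sum (eq_bigr (fun _ => 1)) => [|i _].
    by rewrite sumr_const card_ord pmulrn intz.
  by rewrite hornerXn exprM e2 expr1n.
exists (f + ((w + r)%:P + r%:P * 'X) * S); split.
- rewrite !hornerE S_pm ?expr1n // -[a](subrK f.[1]) uE addrC.
  by rewrite -[u](subrK w) rE; ring.
- by rewrite !hornerE S_pm ?sqrrN ?expr1n // -[b](subrK f.[-1]) wE; ring.
move=> y y2 yp; rewrite !evE; suff -> : ev S y = 0 by rewrite mulr0 addr0.
have nz : y ^+ 2 - 1 != 0 by rewrite subr_eq0.
apply: (mulfI nz); rewrite mulr0 ev_sum.
rewrite (eq_bigr (fun i : 'I_p => (y ^+ 2) ^+ i)).
  by rewrite -subrX1 -exprM yp subrr.
by move=> i _; rewrite evXn exprM.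
Qed.

Lemma Fp_int_eq0 p (a : int) : prime p -> (a%:~R == 0 :> 'F_p) = (p%:Z %| a)%Z.
Proof.
move=> p_pr; rewrite (intEsign a) rmorphM rmorph_sign mulf_eq0 signr_eq0 /=.
by rewrite -pmulrn -(dvdn_pcharf (pchar_Fp p_pr)) dvdzE abszMsign.
Qed.

Lemma group_det_realize p (om : algC) (N a b c d : int) :
  prime p -> odd p -> p.-primitive_root om ->
  (2 %| a - c)%Z -> (2 %| b - d)%Z ->
  local_values p om N (a + b)%:~R (a - b)%:~R (c + d)%:~R (c - d)%:~R ->
  exists x : {ffun 'D_(4 * p) -> int},
    group_det x = (a ^+ 2 - b ^+ 2) * (c ^+ 2 - d ^+ 2) * N.
Proof.
move=> p_pr odd_p prim_om ac bd [f [g [[e1 e2] [e3 e4] NE]]].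
have half (x x' y y' : int) :
    (x + y)%:~R = (x' + y')%:~R :> 'F_p ->
    (x - y)%:~R = (x' - y')%:~R :> 'F_p ->
    (p%:Z %| x' - x)%Z /\ (p%:Z %| y' - y)%Z.
  have nz2 : 2%:~R != 0 :> 'F_p := Fp_pow2_neq0 1 p_pr odd_p.
  rewrite -!(Fp_int_eq0 _ p_pr) !rmorphB !rmorphD /= => es ed.
  split; apply/eqP; apply: (mulfI nz2); rewrite mulr0.
    by rewrite -(subrr (x%:~R + y%:~R + (x%:~R - y%:~R))) {1}es {1}ed; ring.
  by rewrite -(subrr (x%:~R + y%:~R - (x%:~R - y%:~R))) {1}es {1}ed; ring.
have [a_f b_g] := half _ _ _ _ e1 e2; have [c_f d_g] := half _ _ _ _ e3 e4.
have [F [F1 FN1 FE]] := interpolate_pm1 odd_p a_f c_f ac.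
have [G [G1 GN1 GE]] := interpolate_pm1 odd_p b_g d_g bd.
apply/(group_det_values _ p_pr odd_p prim_om); exists F, G.
rewrite prod_dnorm_split ?prime_gt0 // F1 G1 FN1 GN1 !rmorphM /= -NE.
congr (_ * _); apply: eq_big_nat => j lt_j.
have om2 : om ^+ j ^+ 2 != 1.
  by rewrite exprAC (prim_root_exp_neq1 (prim_root_sqr prim_om odd_p)).
have omp : om ^+ j ^+ (2 * p) = 1.
  by rewrite mulnC exprM (prim_root_exp_order _ prim_om) expr1n.
have dnormE w : w ^+ 2 != 1 -> w ^+ (2 * p) = 1 -> dnorm F G w = dnorm f g w.
  move=> w2 wp; have wV2 : w^-1 ^+ 2 != 1 by rewrite exprVn invr_eq1.
  have wVp : w^-1 ^+ (2 * p) = 1 by rewrite exprVn wp invr1.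
  by rewrite /dnorm !FE // !GE.
by rewrite !dnormE ?sqrrN // exprM sqrrN -exprM.
Qed.

(** The contribution [A^2 B^2] of the nonlinear characters when the first linear
character takes the value [e] and the other three take values prime to [p]. *)
Definition ramified_part (p : nat) (e : int) : int :=
  if (p%:Z %| e)%Z then p%:Z ^+ 2 else 1.

Lemma group_det_realize_chars p (a b c d : int) : prime p -> odd p ->
  (2 %| a - c)%Z -> (2 %| b - d)%Z ->
  ~~ (p%:Z %| a - b)%Z -> ~~ (p%:Z %| c + d)%Z -> ~~ (p%:Z %| c - d)%Z ->
  exists x : {ffun 'D_(4 * p) -> int}, group_det x =
    (a ^+ 2 - b ^+ 2) * (c ^+ 2 - d ^+ 2) * ramified_part p (a + b).
Proof.
move=> p_pr odd_p ac bd.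
have [om prim_om] := C_prim_root_exists (prime_gt0 p_pr).
rewrite -!(Fp_int_eq0 _ p_pr) => nz2 nz3 nz4.
apply: (group_det_realize p_pr odd_p prim_om ac bd).
rewrite /ramified_part -(Fp_int_eq0 _ p_pr); case: eqP => [->|/eqP nz1].
  exact: local_values_ramified.
exact: local_values_units.
Qed.

Lemma not_dvdz_pow2 p k : prime p -> odd p -> ~~ (p%:Z %| Posz (2 ^ k))%Z.
Proof.
move=> p_pr odd_p; rewrite dvdzE !absz_nat -prime_coprime // coprimeXr //.
by rewrite coprime_sym coprime2n.
Qed.

Lemma ramified_part_mul2 p (r : int) : prime p -> odd p ->
  ramified_part p (r * 2) = ramified_part p r.
Proof.
move=> p_pr odd_p; rewrite /ramified_part Euclid_dvdzM //.
by rewrite (negPf (not_dvdz_pow2 1 p_pr odd_p)) orbF.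
Qed.

(** Take the character values [r, 1, 1, 1]: then [f(1) = (r + 1) / 2] is odd
like [f(-1) = 1] exactly when [r] is 1 modulo 4. *)
Lemma attained_1mod4 p (r : int) : prime p -> odd p -> (4 %| r - 1)%Z ->
  exists x : {ffun 'D_(4 * p) -> int}, group_det x = r * ramified_part p r.
Proof.
move=> p_pr odd_p /dvdzP[k rE]; have p1 := not_dvdz_pow2 0 p_pr odd_p.
have [||||| x xE] :=
  @group_det_realize_chars p (2 * k + 1) (2 * k) 1 0 p_pr odd_p.
- by rewrite addrK dvdz_mulr.
- by rewrite subr0 dvdz_mulr.
- by rewrite addrAC subrr add0r.
- by rewrite addr0.
- by rewrite subr0.
have sumE : 2 * k + 1 + 2 * k = r by rewrite -[r](subrK 1) rE; ring.
by exists x; rewrite xE sumE; congr (_ * _); rewrite -[RHS]sumE; ring.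
Qed.

(** Take the character values [2 r, 2, 2, 2]. *)
Lemma attained_16odd p (r : int) : prime p -> odd p -> ~~ (2 %| r)%Z ->
  exists x : {ffun 'D_(4 * p) -> int},
    group_det x = 16 * (r * ramified_part p r).
Proof.
move=> p_pr odd_p r_odd; have p2 := not_dvdz_pow2 1 p_pr odd_p.
have [||||| x xE] := @group_det_realize_chars p (r + 1) (r - 1) 2 0 p_pr odd_p.
- by move: r_odd; clear; lia.
- by move: r_odd; clear; lia.
- by rewrite (_ : r + 1 - (r - 1) = 2) //; ring.
- by rewrite addr0.
- by rewrite subr0.
have sumE : r + 1 + (r - 1) = r * 2 by ring.
by exists x; rewrite xE sumE ramified_part_mul2 //; ring.
Qed.

(** Take the character values [2 s, 2, 2, 4]; here [f] and [g] are odd at [1]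
and [-1]. *)
Lemma attained_32even p (s : int) : prime p -> odd p -> (2 %| s)%Z ->
  exists x : {ffun 'D_(4 * p) -> int},
    group_det x = 32 * (s * ramified_part p s).
Proof.
move=> p_pr odd_p s_even; have p2 := not_dvdz_pow2 1 p_pr odd_p.
have p4 := not_dvdz_pow2 2 p_pr odd_p.
have [||||| x xE] :=
  @group_det_realize_chars p (s + 1) (s - 1) 3 (-1) p_pr odd_p.
- by move: s_even; clear; lia.
- by move: s_even; clear; lia.
- by rewrite (_ : s + 1 - (s - 1) = 2) //; ring.
- by [].
- by [].
have sumE : s + 1 + (s - 1) = s * 2 by ring.
by exists x; rewrite xE sumE ramified_part_mul2 //; ring.
Qed.

Theorem theorem5p2 (p : nat) (p_prime : prime p) (p_odd : odd p) :
  (forall v : int,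
     (~~ (2 %| v)%Z /\ exists x : {ffun 'D_(4 * p) -> int}, group_det x = v)
     <->
     ((v = 1 %[mod 4])%Z /\ (~~ (p%:Z %| v)%Z \/ (p%:Z ^+ 3 %| v)%Z)))
  /\
  (forall v : int,
     (v != 0 /\ (2 %| v)%Z /\
      exists x : {ffun 'D_(4 * p) -> int}, group_det x = v)
     <->
     (exists (a b : nat) (m : int),
        [/\ coprimez m (2 * p%:Z),
            (a = 4 \/ 6 <= a)%N,
            (b = 0 \/ 3 <= b)%N
          & v = 2 ^+ a * p%:Z ^+ b * m])).
Proof.
split=> v; split.
- case=> v_odd /(group_det_shape p_prime p_odd).
  case=> a [b [c [d [A [B [ac bd AB [Ap Bp] vE]]]]]].
  split; first by rewrite vE; apply: (odd_value_mod4 ac bd); rewrite -vE.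
  have [p_v|] := boolP (p%:Z %| v)%Z; [right | by left].
  by move: p_v; rewrite vE; apply: dvdz_value_cube.
- case=> /eqP; rewrite eqz_mod_dvd => /dvdzP[k kE] p_v.
  split; first by move: kE; clear; lia.
  case: p_v => [p_v|/dvdzP[t tE]].
    have [|x xE] := attained_1mod4 (r := v) p_prime p_odd.
      by rewrite kE dvdz_mull.
    by exists x; rewrite xE /ramified_part (negPf p_v) mulr1.
  have [|x xE] := attained_1mod4 (r := p%:Z * t) p_prime p_odd.
    (* [p^2] is 1 modulo 4, so [v / p^2] is in the same class as [v] *)
    have [m mE] : exists m, p%:Z = m * 2 + 1.
      by exists p./2%:Z; have := odd_double_half p; rewrite p_odd; clear; lia.
    apply/dvdzP; exists (k - (m ^+ 2 + m) * (p%:Z * t)).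
    have : t * p%:Z ^+ 3 - 1 = k * 4 by rewrite -tE.
    have -> : t * p%:Z ^+ 3 = p%:Z * t + 4 * ((m ^+ 2 + m) * (p%:Z * t)).
      by transitivity (p%:Z ^+ 2 * (p%:Z * t)); [|rewrite {1}mE]; ring.
    by move: (_ * t) (_ * (_ * t)) => y z; clear; lia.
  by exists x; rewrite xE /ramified_part dvdz_mulr // tE; ring.
- case=> nz_v [v_even /(group_det_shape p_prime p_odd)].
  case=> a [b [c [d [A [B [ac bd AB [Ap Bp] vE]]]]]].
  have [e2 [ep [m [cop_m v_fact dvd2 dvdp]]]] :=
    int_2p_factor p_prime p_odd nz_v.
  exists e2, ep, m; split=> //.
  + have [|w wE w24] := even_value_dvd ac bd AB; first by rewrite -vE.
    rewrite -vE in wE; have e2_ge4 : (4 <= e2)%N by rewrite -dvd2 wE dvdz_mulr.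
    have [e2_4|e2_ge5] : e2 = 4 \/ (5 <= e2)%N by move: e2_ge4; clear; lia.
      by left.
    right; rewrite -dvd2 wE (_ : 2 ^+ 6 = 16 * 4) // dvdz_mul2l //; apply: w24.
    by rewrite -(@dvdz_mul2l 16) // -wE (_ : 16 * 2 = 2 ^+ 5) // dvd2.
  + have [ep0|ep_gt0] := posnP ep; [by left | right].
    rewrite -dvdp vE; apply: dvdz_value_cube => //.
    by rewrite -vE -[p%:Z]expr1 dvdp.
- case=> a [b [m [cop_m a_ok b_ok vE]]].
  have [m_odd p_m] : ~~ (2 %| m)%Z /\ ~~ (p%:Z %| m)%Z.
    move: cop_m; rewrite coprimezE abszM !absz_nat coprimeMr => /andP[m2 mp].
    split; first by rewrite dvdzE dvdn2 negbK -coprime2n coprime_sym.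
    by rewrite dvdzE absz_nat -prime_coprime // coprime_sym.
  have pX_odd k : ~~ (2 %| p%:Z ^+ k * m)%Z.
    rewrite dvd2zM negb_or m_odd andbT dvdzE abszX absz_nat.
    by rewrite Euclid_dvdX // negb_and dvdn2 p_odd.
  have [r [r_odd rE]] :
      exists r, ~~ (2 %| r)%Z /\ r * ramified_part p r = p%:Z ^+ b * m.
    case: b_ok {vE} => [->|b_ge3].
      by exists m; rewrite /ramified_part (negPf p_m) mulr1 expr0 mul1r.
    exists (p%:Z ^+ (b - 2) * m); split=> //; rewrite /ramified_part dvdz_mulr.
      by rewrite mulrAC -exprD subnK // ltnW.
    by rewrite dvdz_exp // subn_gt0.
  have nz_v : v != 0.
    rewrite vE -mulrA mulf_neq0 ?expf_neq0 //.
    by apply: contraNneq (pX_odd b) => ->.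
  have v_even : (2 %| v)%Z.
    rewrite vE -mulrA dvdz_mulr // dvdz_exp //.
    by case: a_ok => [->|a_ge6] //; apply: leq_trans a_ge6.
  split=> //; split=> //; rewrite vE -mulrA -rE.
  case: a_ok => [->|a_ge6].
    by have [x xE] := attained_16odd p_prime p_odd r_odd; exists x; rewrite xE.
  have [|x xE] := attained_32even (s := 2 ^+ (a - 5) * r) p_prime p_odd.
    by rewrite dvdz_mulr // dvdz_exp // subn_gt0.
  have ramE j : ramified_part p (2 ^+ j * r) = ramified_part p r.
    elim: j => [|j IHj]; rewrite ?expr0 ?mul1r //.
    by rewrite exprSr mulrAC ramified_part_mul2.
  exists x; rewrite xE ramE -[in RHS](@subnK 5 a) ?exprD; last exact: ltnW.
  by rewrite (_ : 2 ^+ 5 = 32) //; ring.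
Qed.
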